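(* Let $n\ge4$ and $1\le k_2\le n-3$ be integers. Then for any $\mu\in\mathfrak{P}_{n-1,n-1+k_2}$ with $|\mu|\ge n-1$, we have $$\mathscr{C}_{\mu,n-1,k_2}=\mathscr{C}_{\mu,n-2,k_2+1}.$$
   Context: For positive integers $m,k$, $\mathfrak{P}_{m,k}$ is the set of $m$-tuples of nonnegative integers $p=(p_1,\dots,p_m)$ with $p_1+2p_2+\cdots+mp_m=k$; put $|p|=p_1+\cdots+p_m$ and $\mathfrak{P}_k=\mathfrak{P}_{k,k}$. Write $\binom{|p|}{p_1,\dots,p_m}=\frac{|p|!}{p_1!\cdots p_m!}$. Let $k_1\ge k_2$ be positive integers and $\mu=(\mu_1,\dots,\mu_{k_1})\in\mathfrak{P}_{k_1,k_1+k_2}$. For $p\in\mathfrak{P}_{k_1}$ and $q\in\mathfrak{P}_{k_2}$ put $p+q=(p_1+q_1,\dots,p_{k_2}+q_{k_2},p_{k_2+1},\dots,p_{k_1})$. Define $$\mathscr{C}_{\mu,k_1,k_2}=\sum_{p\in\mathfrak{P}_{k_1},\,q\in\mathfrak{P}_{k_2},\,p+q=\mu}\binom{|p|}{p_1,\dots,p_{k_1}}\binom{|q|}{q_1,\dots,q_{k_2}},$$ with $\mathscr{C}_{\mu,k_1,k_2}=0$ if there are no such $p,q$. For $n\ge4$ and $1\le k_2\le n-3$, any $\mu\in\mathfrak{P}_{n-1,n-1+k_2}$ with $|\mu|\ge n-1$ has $\mu_{n-1}=0$, so $\mu$ is also considered as an element $(\mu_1,\dots,\mu_{n-2})$ of $\mathfrak{P}_{n-2,n-1+k_2}$;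 this is the meaning of $\mu$ in $\mathscr{C}_{\mu,n-2,k_2+1}$. *)

(* Defs.v *)
From mathcomp Require Import all_boot.

Set Implicit Arguments.
Unset Strict Implicit.
Unset Printing Implicit Defensive.

(* An m-tuple (p_1, ..., p_m) is p : m.-tuple nat, with p_j = nth 0 p (j - 1);
   nth 0 makes entries beyond m equal to 0. *)

Definition wt m (p : m.-tuple nat) : nat := \sum_(i < m) i.+1 * nth 0 p i.

Definition abst m (p : m.-tuple nat) : nat := \sum_(i < m) nth 0 p i.

Definition PP m k : {pred m.-tuple nat} := [pred p | wt p == k].
Arguments PP : clear implicits.

Lemma prod_fact_dvd m (p : m.-tuple nat) :
  \prod_(i < m) (nth 0 p i)`! %| (abst p)`!.
Proof.
rewrite /abst; elim/big_rec2: _ => // i s d _ dvd_ds.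
rewrite -(bin_fact (leq_addr s (nth 0 p i))) addKn.
by rewrite dvdn_mull ?dvdn_mul.
Qed.

(* The division is exact by prod_fact_dvd. *)
Definition multinom m (p : m.-tuple nat) : nat :=
  (abst p)`! %/ \prod_(i < m) (nth 0 p i)`!.

(* PP m k is finite but m.-tuple nat is not a finType; since the entries of an
   element of PP m k are at most k, it can be enumerated as follows. *)
Definition enumPP m k : seq (m.-tuple nat) :=
  [seq p <- [seq map_tuple val f | f : m.-tuple 'I_k.+1] | p \in PP m k].

Lemma enumPP_uniq m k : uniq (enumPP m k).
Proof.
apply/filter_uniq/dinjectiveP => f g _ _ /(congr1 val) /= /(inj_map val_inj).
exact: val_inj.
Qed.

Lemma mem_enumPP m k : enumPP m k =i PP m k.
Proof.
move=> p; rewrite mem_filter andb_idr // => /eqP wtp.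
have le_pk i : tnth p i < k.+1.
  rewrite ltnS -wtp /wt (bigD1 i) //= -tnth_nth.
  by rewrite (leq_trans (leq_pmull _ (ltn0Sn i))) ?leq_addr.
apply/imageP; exists [tuple Ordinal (le_pk i) | i < m] => //.
by apply/eq_from_tnth => i; rewrite tnth_map tnth_mktuple.
Qed.

(* Used for k2 <= k1. *)
Definition addt k1 k2 (p : k1.-tuple nat) (q : k2.-tuple nat) :
    k1.-tuple nat :=
  [tuple nth 0 p i + nth 0 q i | i < k1].

Definition CC k1 k2 (mu : k1.-tuple nat) : nat :=
  \sum_(p <- enumPP k1 k1) \sum_(q <- enumPP k2 k2 | addt p q == mu)
    multinom p * multinom q.
Arguments CC : clear implicits.

(* The tuple (mu_1, ..., mu_l), for l <= m. *)
Definition trunct l m (mu : m.-tuple nat) : l.-tuple nat :=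
  [tuple nth 0 mu i | i < l].
Arguments trunct l {m} mu.

(* In the range considered, truncation to n - 2 entries only drops a zero. *)
Lemma last_entry_eq0 n k2 (mu : (n - 1).-tuple nat) :
  4 <= n -> 1 <= k2 <= n - 3 -> mu \in PP (n - 1) (n - 1 + k2) ->
  n - 1 <= abst mu -> nth 0 mu (n - 2) = 0.
Proof.
move=> n4 /andP[_ k2n] /eqP wtmu abmu.
have wtE : wt mu = abst mu + \sum_(i < n - 1) i * nth 0 mu i.
  by rewrite /wt /abst -big_split; apply: eq_bigr => i _; rewrite mulSn.
have le_k2 : \sum_(i < n - 1) i * nth 0 mu i <= k2.
  by rewrite -(leq_add2l (n - 1)) -wtmu wtE leq_add2r.
have lt_n : n - 2 < n - 1 by case: n n4 {mu k2n wtmu abmu wtE le_k2} => [|[|n]]; rewrite // !subSS !subn0.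
move: le_k2; rewrite (bigD1 (Ordinal lt_n)) //= => le_k2.
have {le_k2} : (n - 2) * nth 0 mu (n - 2) < n - 2.
  apply: leq_ltn_trans (leq_trans (leq_addr _ _) (leq_trans le_k2 k2n)) _.
  by apply: ltn_sub2l => //; apply: leq_trans n4.
case: (nth 0 mu (n - 2)) => // x; rewrite ltnNge.
by rewrite leq_pmulr.
Qed.

(* Main.v *)
(* The number C_{mu,k1,k2} counts the words on positive letters, of content mu,
   that have a prefix of sum k1.  For a multiset s of letters let H(s, j) be the
   number of its rearrangements having a prefix of sum j.  Deleting the first
   letter gives H(s, j + 1) = sum_x H(s - x, j + 1 - x), while deleting the last
   one gives H(s, j) = sum_x H(s - x, j) for j < sum s, both over the distinct
   letters x of s.  By induction on the size of s, the right-hand sides agree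
   term by term, so that H(s, .) is constant on the interval
   [sum s - size s, size s], which contains n - 2 and n - 1. *)

Require Import Defs.
From mathcomp Require Import all_boot zify.

Set Implicit Arguments.
Unset Strict Implicit.
Unset Printing Implicit Defensive.

(** * Rearrangements: splitting off the last letter, and the multinomial count *)

Lemma permutations_rev (T : eqType) (s : seq T) :
  perm_eq (map rev (permutations s)) (permutations s).
Proof.
have rev_inj := can_inj (@revK T).
apply: uniq_perm; rewrite ?(map_inj_uniq rev_inj) ?permutations_uniq // => w.
by rewrite -[w in LHS]revK (mem_map rev_inj) !mem_permutations perm_rev.
Qed.

(** Reversal permutes the rearrangements of [s], which carries the first-letter recursion
    [permutationsE] over to the last letter. *)
Lemma permutations_rcons (T : eqType) (s : seq T) : 0 < size s ->
  perm_eq (permutations s)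
    [seq rcons t x | x <- undup s, t <- permutations (rem x s)].
Proof.
move=> s_gt0; apply/permP => P; rewrite -(permP (permutations_rev s)).
rewrite count_map (permP (permutationsE s_gt0)) !count_flatten -!map_comp.
congr sumn; apply: eq_map => x /=; rewrite [RHS]count_map.
rewrite -(permP (permutations_rev _)) !count_map.
by apply: eq_count => t; rewrite /= rev_cons.
Qed.

(** Induction on [size s], splitting by first letter. Since [r] may be larger than the set of
    letters of [s], the range of the product stays fixed when a letter is removed. *)
Lemma size_permutations_count (T : eqType) (r s : seq T) :
    uniq r -> {subset s <= r} ->
  size (permutations s) * \prod_(x <- r) (count_mem x s)`! = (size s)`!.
Proof.
move=> uniq_r; have [n] := ubnP (size s).
elim: n s => // n IHn s lt_sn s_r.
have [/size0nil-> | s_gt0] := posnP (size s); first by rewrite big1 ?muln1.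
have sub_step x : x \in s -> size (permutations (rem x s)) *
    \prod_(z <- r) (count_mem z s)`! = count_mem x s * (size s).-1`!.
  move=> s_x; have r_x := s_r x s_x.
  rewrite -(size_rem s_x) -IHn; first last.
  - by move=> z /mem_rem/s_r.
  - by rewrite size_rem ?prednK.
  rewrite !(bigD1_seq x) //= [RHS]mulnCA; congr (_ * _).
  rewrite mulnA; congr (_ * _); last first.
    by apply: eq_bigr => z z_x; rewrite count_rem s_x /= eq_sym (negPf z_x) subn0.
  rewrite count_rem s_x /= eqxx.
  by rewrite -has_pred1 has_count in s_x; rewrite -(prednK s_x) factS subn1.
rewrite (perm_size (permutationsE _)) // size_allpairs_dep sumnE big_map.
rewrite big_distrl /= (eq_big_seq (fun x => count_mem x s * (size s).-1`!)).
  rewrite -big_distrl /=.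
  (* The multiplicities of the distinct letters add up to [size s]. *)
  have := big_undup_iterop_count addn s xpredT (fun => 1).
  rewrite sum1_size => sum_count; rewrite -[in RHS](prednK s_gt0) factS prednK //.
  congr (_ * _); rewrite -sum_count.
  by apply: eq_bigr => x _; rewrite Monoid.iteropE iter_addn_0 mul1n.
by move=> x; rewrite mem_undup; apply: sub_step.
Qed.

(** * Words having a prefix of prescribed sum *)

Definition hits j (w : seq nat) :=
  has (fun i => sumn (take i w) == j) (iota 0 (size w).+1).

Lemma hitsP j w : reflect (exists i, sumn (take i w) = j) (hits j w).
Proof.
apply: (iffP hasP) => [[i _ /eqP <-] | [i <-]]; first by exists i.
exists (minn i (size w)); first by rewrite mem_iota ltnS geq_minr.
by case: leqP => // lt_wi; rewrite take_size take_oversize // ltnW.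
Qed.

(** A positive target rules out the empty prefix, so the prefix contains [x]. *)
Lemma hits_cons j x t : hits j.+1 (x :: t) = (x <= j.+1) && hits (j.+1 - x) t.
Proof.
apply/hitsP/andP => [[[|i] //= def_j] | [le_xj /hitsP[i def_j]]].
  split; first by rewrite -def_j leq_addr.
  by apply/hitsP; exists i; rewrite -def_j addKn.
by exists i.+1; rewrite /= def_j subnKC.
Qed.

(** The whole word overshoots [j], so a prefix of sum [j] lies within [t]. *)
Lemma hits_rcons j x t : j < sumn t + x -> hits j (rcons t x) = hits j t.
Proof.
move=> lt_j; apply/hitsP/hitsP => -[i def_j].
  have [le_it | lt_ti] := leqP i (size t).
    by exists i; rewrite -def_j -cats1 takel_cat.
  by rewrite take_oversize ?size_rcons // sumn_rcons in def_j; rewrite -def_j ltnn in lt_j.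
exists (minn i (size t)); rewrite -cats1 takel_cat ?geq_minr //.
by case: leqP => // lt_ti; rewrite take_size -def_j take_oversize // ltnW.
Qed.

Definition nhits j s := count (hits j) (permutations s).

Lemma nhits_first j s : 0 < size s ->
  nhits j.+1 s =
    \sum_(x <- undup s | x <= j.+1) nhits (j.+1 - x) (rem x s).
Proof.
move=> s_gt0; rewrite /nhits (permP (permutationsE s_gt0)).
rewrite count_flatten sumnE big_map big_map [RHS]big_mkcond; apply: eq_bigr => x _.
rewrite count_map; case: ifP => le_xj.
  by apply: eq_count => t /=; rewrite hits_cons le_xj.
apply/eqP; rewrite -leqn0 leqNgt -has_count -all_predC.
by apply/allP => t _ /=; rewrite hits_cons le_xj.
Qed.

Lemma nhits_last j s : j < sumn s ->
  nhits j s = \sum_(x <- undup s) nhits j (rem x s).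
Proof.
move=> lt_js.
have s_gt0 : 0 < size s by case: s lt_js.
rewrite /nhits (permP (permutations_rcons s_gt0)).
rewrite count_flatten sumnE big_map big_map; apply: eq_big_seq => x.
rewrite mem_undup => s_x; rewrite count_map.
apply: eq_in_count => t; rewrite mem_permutations => pt /=.
rewrite hits_rcons // (perm_sumn pt).
by move: lt_js; rewrite (perm_sumn (perm_to_rem s_x)) /= addnC.
Qed.

Lemma size_le_sumn (s : seq nat) : 0 \notin s -> size s <= sumn s.
Proof.
elim: s => //= x s IHs; rewrite inE negb_or eq_sym -lt0n => /andP[x_gt0 /IHs le_s].
by rewrite -add1n leq_add.
Qed.

Lemma nhits_const (s : seq nat) i j : 0 \notin s ->
    sumn s <= size s + i -> i <= j <= size s ->
  nhits i s = nhits j s.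
Proof.
have [n] := ubnP (size s); elim: n s i j => // n IHn s i j lt_sn s0 le_si.
elim: j => [|j IHj] /andP[le_ij le_js].
  by move: le_ij; rewrite leqn0 => /eqP->.
move: le_ij; rewrite leq_eqVlt => /predU1P[-> // | le_ij].
rewrite IHj; last by rewrite -ltnS le_ij ltnW.
have s_gt0 : 0 < size s by apply: leq_trans le_js.
rewrite nhits_first // nhits_last; last exact: leq_trans (size_le_sumn s0).
rewrite [RHS]big_mkcond; apply: eq_big_seq => /= x; rewrite mem_undup => s_x.
have x_gt0 : 0 < x by rewrite lt0n; apply: contraNneq s0 => <-.
have rem0 : 0 \notin rem x s by apply: contra s0; apply: mem_rem.
have := size_le_sumn rem0.
have := perm_sumn (perm_to_rem s_x); have := size_rem s_x => /= sz_rem sum_s le_rem.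
(* The other letters sum to at least [size s - 1], so [x <= i + 1 <= j + 1] and no term is lost.
   Induction then applies to [rem x s] between [j + 1 - x] and [j]: its sum drops by [x] and its
   size by 1. *)
case: leqP => [le_xj|]; last by lia.
by apply/esym/IHn => //; lia.
Qed.

(** * Tuples as contents of words *)

Definition letters m : pred (seq nat) := all (fun x => 0 < x <= m).

Definition content m (w : seq nat) : m.-tuple nat :=
  [tuple count_mem i.+1 w | i < m].

Definition word m (p : m.-tuple nat) : seq nat :=
  flatten [seq nseq (nth 0 p i) i.+1 | i <- iota 0 m].

Lemma nth_content m w i :
  letters m w -> nth 0 (content m w) i = count_mem i.+1 w.
Proof.
move=> w_m; have [lt_im | le_mi] := ltnP i m.
  by rewrite -[i]/(val (Ordinal lt_im)) -tnth_nth tnth_mktuple.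
rewrite nth_default ?size_tuple //; apply/esym/count_memPn.
by apply/negP => /(allP w_m) /=; rewrite ltnNge le_mi.
Qed.

Lemma count_word m (p : m.-tuple nat) x :
  count_mem x (word p) = if x is i.+1 then nth 0 p i else 0.
Proof.
rewrite count_flatten sumnE !big_map.
under eq_bigr do rewrite count_nseq.
case: x => [|i]; first by rewrite big1.
have [lt_im | le_mi] := ltnP i m; last first.
  rewrite nth_default ?size_tuple // big1_seq // => k.
  by rewrite mem_iota => /andP[_ /andP[_ lt_km]] /=; rewrite eqSS ltn_eqF // (leq_trans lt_km).
rewrite (bigD1_seq i) ?mem_iota ?iota_uniq //= eqxx mul1n big1 ?addn0 // => k.
by rewrite eqSS => /negPf->.
Qed.

(** The condition [letters m w] is essential: [content m] does not see letters outside 1, ..., m. *)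
Lemma perm_word m (p : m.-tuple nat) w :
  perm_eq w (word p) = letters m w && (content m w == p).
Proof.
apply/idP/andP => [w_p | [w_m /eqP <-]].
  have w_m : letters m w.
    apply/allP => -[|i]; rewrite -has_pred1 has_count (permP w_p) count_word //=.
    by move=> nth_gt0; rewrite ltnNge; apply: contraL nth_gt0 => le_mi; rewrite nth_default ?size_tuple.
  split=> //; apply/eqP/eq_from_tnth => i.
  by rewrite tnth_mktuple (permP w_p) count_word (tnth_nth 0).
apply/allP => x _ /=; rewrite count_word; case: x => [|i]; last by rewrite nth_content.
by apply/eqP/count_memPn/negP => /(allP w_m).
Qed.

Lemma sum_letters m w (F : nat -> nat) : letters m w ->
  \sum_(x <- w) F x = \sum_(i < m) F i.+1 * nth 0 (content m w) i.
Proof.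
move=> w_m; under [RHS]eq_bigr do rewrite nth_content //.
elim: w w_m => [|x w IHw] /=; first by rewrite big_nil big1 // => i _; rewrite muln0.
case/andP; case: x => // x lt_xm /IHw{}IHw.
under [RHS]eq_bigr do rewrite mulnDr.
rewrite big_cons big_split IHw /= [in RHS](bigD1 (Ordinal lt_xm)) //= eqxx muln1.
congr (_ + _); rewrite big1 ?addn0 // => i /eqP i_x.
by case: eqP => [[eq_xi]|]; rewrite ?muln0 //; case: i_x; apply/val_inj.
Qed.

Lemma wt_content m w : letters m w -> wt (content m w) = sumn w.
Proof. by move=> w_m; rewrite sumnE (sum_letters id w_m). Qed.

Lemma abst_content m w : letters m w -> abst (content m w) = size w.
Proof.
move=> w_m; rewrite -sum1_size (sum_letters (fun=> 1) w_m).
by apply: eq_bigr => i _; rewrite mul1n.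
Qed.

Lemma letters_word m (p : m.-tuple nat) : letters m (word p).
Proof. by have := perm_word p (word p); rewrite perm_refl; case/esym/andP. Qed.

Lemma content_word m (p : m.-tuple nat) : content m (word p) = p.
Proof.
by have := perm_word p (word p); rewrite perm_refl; case/esym/andP => _ /eqP.
Qed.

Lemma multinomE m (p : m.-tuple nat) : multinom p = size (permutations (word p)).
Proof.
rewrite /multinom -[in abst p](content_word p) abst_content ?letters_word //.
rewrite -(@size_permutations_count _ (iota 1 m)) ?iota_uniq //; last first.
  by move=> x /(allP (letters_word p)); rewrite mem_iota add1n ltnS.
rewrite (iotaDl 1 0 m : iota 1 m = _) big_map -[m in iota 0 m]subn0 big_mkord.
under [\prod_(i < m) _]eq_bigr do rewrite count_word.
rewrite mulnK // prodn_gt0 // => i; exact: fact_gt0.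
Qed.

(** Grouping the words by content lets a sum over words split as a sum over [enumPP], as in [CC]. *)
Definition words m k : seq (seq nat) :=
  [seq w | p <- enumPP m k, w <- permutations (word p)].

Lemma mem_words m k w : (w \in words m k) = letters m w && (sumn w == k).
Proof.
apply/allpairsPdep/andP => [[p [v [p_k]]] | [w_m /eqP w_k]].
  rewrite mem_permutations perm_word mem_enumPP in p_k * => /andP[v_m /eqP def_p] ->.
  by rewrite -(wt_content v_m) def_p.
exists (content m w), w; rewrite mem_enumPP mem_permutations perm_word w_m eqxx.
by rewrite inE wt_content // w_k.
Qed.

Lemma words_uniq m k : uniq (words m k).
Proof.
apply: allpairs_uniq_dep => [|p _|]; rewrite ?enumPP_uniq ?permutations_uniq //.
move=> _ _ /allpairsPdep[p [v [_ v_p ->]]] /allpairsPdep[q [w [_ w_q ->]]] /= eq_vw.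
rewrite !mem_permutations !perm_word in v_p w_q.
by case/andP: v_p w_q => _ /eqP <- /andP[_ /eqP <-]; rewrite eq_vw.
Qed.

(** * From [CC] to pairs of words, and from pairs to cut words *)

Lemma CC_sum_words k1 k2 mu : CC k1 k2 mu =
  \sum_(v <- words k1 k1) \sum_(w <- words k2 k2)
    (addt (content k1 v) (content k2 w) == mu).
Proof.
rewrite big_allpairs_dep; apply: eq_bigr => p _.
rewrite (eq_big_seq (fun => \sum_(q <- enumPP k2 k2 | addt p q == mu) multinom q)).
  rewrite big_const_seq count_predT iter_addn_0 mulnC multinomE big_distrr /=.
  by apply: eq_bigr => q _; rewrite multinomE.
move=> v; rewrite mem_permutations perm_word => /andP[_ /eqP ->].
rewrite big_allpairs_dep [RHS]big_mkcond; apply: eq_bigr => q _.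
rewrite (eq_big_seq (fun => (addt p q == mu) : nat)).
  rewrite big_const_seq count_predT iter_addn_0 multinomE.
  by case: eqP; rewrite ?mul1n.
by move=> w; rewrite mem_permutations perm_word => /andP[_ /eqP ->].
Qed.

Lemma letters_widen m n w : m <= n -> letters m w -> letters n w.
Proof.
move=> le_mn; apply: sub_all => x /andP[-> /leq_trans->] //.
Qed.

(** Contents add under concatenation; as [k2 <= k1], the [k1] entries kept by [addt] cover every
    letter of [w]. *)
Lemma addt_content k1 k2 v w s : k2 <= k1 ->
    letters k1 v -> letters k2 w -> letters k1 s ->
  (addt (content k1 v) (content k2 w) == content k1 s) = perm_eq (v ++ w) s.
Proof.
move=> le_k v_k w_k s_k.
have -> : addt (content k1 v) (content k2 w) = content k1 (v ++ w).
  by apply: eq_from_tnth => i; rewrite !tnth_mktuple !nth_content ?count_cat.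
have /esym := perm_word (content k1 s) (v ++ w).
rewrite {1}/letters all_cat -!/(letters _ _) v_k (letters_widen le_k w_k) /= => ->.
by apply: (permPr _); rewrite perm_sym perm_word s_k eqxx.
Qed.

(** With positive letters the partial sums strictly increase, so a word has at most one prefix of a
    given sum. This makes the cut unique. *)
Lemma cat_inj_sumn (u v w t : seq nat) : 0 \notin u -> 0 \notin v ->
  sumn u = sumn v -> u ++ w = v ++ t -> u = v.
Proof.
elim: u v => [|x u IHu] [|y v] //= u0 v0; rewrite ?inE in u0 v0.
- by case: y v0.
- by case: x u0.
move=> eq_s [eq_xy eq_uv]; rewrite {}eq_xy in u0 eq_s *.
move: u0 v0; rewrite !negb_or => /andP[_ u0] /andP[_ v0].
by congr (_ :: _); apply: IHu eq_uv => //; apply: addnI eq_s.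
Qed.

Lemma letters_gt0 m w : letters m w -> 0 \notin w.
Proof. by move=> w_m; apply/negP => /(allP w_m). Qed.

Lemma letters_sumn (w : seq nat) : 0 \notin w -> letters (sumn w) w.
Proof.
move=> w0; apply/allP => x w_x; rewrite (perm_sumn (perm_to_rem w_x)) leq_addr.
by rewrite lt0n andbT; apply: contraNneq w0 => <-.
Qed.

(* A word rearranging [s] with a prefix of sum [k1] is cut by that prefix into
   two words, of contents p and q. *)
Lemma CC_nhits k1 k2 s : k2 <= k1 -> letters k1 s -> sumn s = k1 + k2 ->
  CC k1 k2 (content k1 s) = nhits k1 s.
Proof.
move=> le_k s_k sum_s.
pose pairs := [seq (v, w) | v <- words k1 k1, w <- words k2 k2].
pose P (x : seq nat * seq nat) := perm_eq (x.1 ++ x.2) s.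
have pairsP v w : (v, w) \in pairs -> [/\ letters k1 v, sumn v = k1 & letters k2 w].
  case/allpairsP => -[a b] [/= a_in b_in [-> ->]]; move: a_in b_in.
  by rewrite !mem_words => /andP[-> /eqP ->] /andP[-> _].
have -> : CC k1 k2 (content k1 s) = count P pairs.
  rewrite CC_sum_words -sum1_count [RHS]big_mkcond big_allpairs.
  apply: eq_big_seq => v v_in; apply: eq_big_seq => w w_in.
  rewrite !mem_words in v_in w_in; case/andP: v_in w_in => v_k _ /andP[w_k _].
  by rewrite addt_content // /P /=; case: perm_eq.
(* Concatenation is a bijection from the pairs satisfying [P] to the rearrangements of [s] that hit
   [k1]. *)
rewrite /nhits -!size_filter -(size_map (fun x => x.1 ++ x.2)).
apply/perm_size/uniq_perm; last 1 first.
- move=> u; rewrite mem_filter mem_permutations.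
  apply/mapP/andP => [[[v w]] | [/hitsP[i sum_v] u_s]].
    rewrite mem_filter => /andP[vw_s /pairsP[_ v_k1 _]] -> /=; split=> //.
    by apply/hitsP; exists (size v); rewrite take_size_cat.
  have : letters k1 u by rewrite /letters (perm_all _ u_s).
  rewrite -[u](cat_take_drop i) /letters all_cat -!/(letters _ _) => /andP[t_k d_k].
  exists (take i u, drop i u); rewrite ?cat_take_drop // mem_filter /P /= cat_take_drop u_s.
  have sum_d : sumn (drop i u) = k2.
    by apply/(@addnI k1); rewrite -sum_s -(perm_sumn u_s) -[u in RHS](cat_take_drop i) sumn_cat sum_v.
  apply/allpairs_f; rewrite mem_words ?t_k ?sum_v ?sum_d eqxx ?andbT //.
  (* The suffix is only known to have letters up to [k1]; its sum [k2] bounds them by [k2]. *)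
  by rewrite -[X in letters X]sum_d; apply/letters_sumn/letters_gt0/d_k.
- rewrite map_inj_in_uniq.
    by rewrite filter_uniq // allpairs_uniq ?words_uniq // => -[? ?] [? ?].
  move=> [v w] [v' w']; rewrite !mem_filter => /andP[_ /pairsP[v0 sv _]].
  move=> /andP[_ /pairsP[v0' sv' _]] /= eq_vw.
  have eq_v : v = v' by apply: cat_inj_sumn eq_vw; rewrite ?sv ?(letters_gt0 v0) ?(letters_gt0 v0').
  by move: eq_vw; rewrite eq_v => /eqP; rewrite eqseq_cat // eqxx => /eqP->.
- by rewrite filter_uniq ?permutations_uniq.
Qed.

Theorem corollary5p2 (n k2 : nat) (hn : 4 <= n) (hk2 : 1 <= k2 <= n - 3)
    (mu : (n - 1).-tuple nat) (hmu : mu \in PP (n - 1) (n - 1 + k2))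
    (habs : n - 1 <= abst mu) :
  CC (n - 1) k2 mu = CC (n - 2) (k2 + 1) (trunct (n - 2) mu).
Proof.
have last0 := last_entry_eq0 hn hk2 hmu habs.
move/eqP: hmu => wtmu.
pose s := word mu; have s_n1 : letters (n - 1) s by apply: letters_word.
have mu_s : mu = content (n - 1) s by rewrite content_word.
have sum_s : sumn s = n - 1 + k2 by rewrite -wtmu mu_s wt_content.
have size_s : n - 1 <= size s by rewrite -(abst_content s_n1) -mu_s.
have s_n2 : letters (n - 2) s.
  apply/allP => x s_x; have /andP[-> le_xn] := allP s_n1 x s_x.
  rewrite leqNgt; apply: contraL s_x => lt_nx; apply/count_memPn.
  (* Letter [n - 1] is counted by the entry of index [n - 2], which vanishes by [last0]. *)
  by have -> : x = (n - 2).+1 by [lia]; rewrite count_word.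
have -> : trunct (n - 2) mu = content (n - 2) s.
  by apply: eq_from_tnth => i; rewrite !tnth_mktuple count_word.
(* The same word [s] serves both sides, as its sum is also [(n - 2) + (k2 + 1)]; the bound
   [k2 <= n - 3] gives [k2 + 1 <= n - 2]. *)
rewrite {1}mu_s !CC_nhits //; try lia.
(* Both targets are in range: [sumn s - size s <= k2 <= n - 2] and [n - 1 <= size s]. *)
by apply/esym/nhits_const; [apply: letters_gt0 s_n1 | lia..].
Qed.
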